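(* Let $n=16p_1p_2\cdots p_i$, where $i\ge0$ and $p_1,\dots,p_i$ are mutually distinct odd primes. Then the number of proper skew morphisms of $\mathbb{Z}_n$ of order $4$ is $2^{i+2}$. In particular, $4$ is not skew bounded.
   Context: $\mathbb{Z}_n$ is the cyclic group of integers modulo $n$. A skew morphism of a finite group $G$ is a permutation $\varphi$ of $G$ fixing the identity such that for each $a\in G$ there is a non-negative integer $i_a$ with $\varphi(ab)=\varphi(a)\varphi^{i_a}(b)$ for all $b\in G$. A skew morphism that is not a group automorphism is called proper. The order of $\varphi$ is the order of $\langle\varphi\rangle$. A positive integer $\ell$ is called skew bounded if there is a constant $C$ such that for every positive integer $n$ the number of proper skew morphisms of $\mathbb{Z}_n$ of order $\ell$ is at most $C$. *)

(* Defs.v *)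
From HB Require Import structures.
From mathcomp Require Import all_boot all_order all_algebra all_fingroup.
Set Implicit Arguments. Unset Strict Implicit. Unset Printing Implicit Defensive.
Import GRing.Theory.

(* The cyclic group Z_n for n > 0: integers modulo n, realised as 'I_n
   (written 'I_(n.-1.+1) so that its canonical zmodType structure applies;
   for n > 0 this is exactly 'I_n with addition modulo n). *)
Definition Zn (n : nat) : finZmodType := 'I_(n.-1.+1).

Definition skew_morphism (n : nat) (phi : {perm Zn n}) : Prop :=
  phi 0%R = 0%R /\
  forall a : Zn n, exists i : nat, forall b : Zn n,
    phi (a + b)%R = (phi a + (phi ^+ i)%g b)%R.

Definition group_automorphism (n : nat) (phi : {perm Zn n}) : Prop :=
  forall a b : Zn n, phi (a + b)%R = (phi a + phi b)%R.

Definition proper_skew_of_order (n l : nat) (phi : {perm Zn n}) : Prop :=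
  skew_morphism phi /\ ~ group_automorphism phi /\ #[phi]%g = l.

Definition has_card (T : finType) (P : T -> Prop) (N : nat) : Prop :=
  exists s : seq T, uniq s /\ (forall x, x \in s <-> P x) /\ size s = N.

Definition skew_bounded (l : nat) : Prop :=
  exists C : nat, forall n : nat, 0 < n ->
    forall N : nat, has_card (@proper_skew_of_order n l) N -> N <= C.

(* Main.v *)
(* Let phi be a skew morphism of order 4 and let K be its kernel, the set of
   a with phi(a + b) = phi(a) + phi(b) for all b. The four power values met
   along an orbit are the steps of a cyclic walk through Z_4; since phi
   preserves K, this leaves only the values 1 and 3. If phi is proper, then 1
   has power value 3, K consists of the even residues, and with m = n/2
   phi is 2x |-> 2rx, 2x+1 |-> 2(rx+h)+1 for a pair (r, h) modulo m with
   r^2 = 1, r(1+h) = 1+h, 2h(1+r) = 0 and h(1+r) <> 0; conversely every such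
   pair gives a proper skew morphism of order 4. For m = 8 p_1 ... p_i the
   Chinese remainder theorem splits these pairs into 4 choices modulo 8 and,
   modulo each odd prime, the two choices (1, 0) and (-1, -1). *)

Require Import Defs.
From mathcomp Require Import all_boot all_order all_algebra all_fingroup.
From mathcomp Require Import cyclic ring.
Set Implicit Arguments. Unset Strict Implicit. Unset Printing Implicit Defensive.
Import GRing.Theory.

(** * Power values and the kernel of a skew morphism of order 4 *)

Section PowerValues.
Local Open Scope ring_scope.
Variables (G : finZmodType) (phi : {perm G}).

(** Stated for all powers of [phi], so that values can be summed along an orbit; [power_value 1 a 1]
    means that [a] lies in the kernel. *)
Definition power_value (k : nat) (a : G) (i : nat) : Prop :=
  forall b, (phi ^+ k)%g (a + b) = (phi ^+ k)%g a + (phi ^+ i)%g b.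

Definition skew_perm : Prop := phi 0 = 0 /\ forall a, exists i, power_value 1 a i.

Lemma perm_expgD (j k : nat) x : (phi ^+ (j + k))%g x = (phi ^+ k)%g ((phi ^+ j)%g x).
Proof. by rewrite expgD permM. Qed.

Lemma power_value_comp j k a i i' :
  power_value j a i -> power_value k ((phi ^+ j)%g a) i' ->
  power_value (j + k) a (i + i').
Proof. by move=> Hj Hk b; rewrite perm_expgD Hj Hk !perm_expgD. Qed.

Lemma power_value_add k a b i j :
  power_value k a i -> power_value i b j -> power_value k (a + b) j.
Proof. by move=> Ha Hb c; rewrite (Ha b) -addrA (Ha (b + c)) Hb addrA. Qed.

Hypothesis skew : skew_perm.

Let iter_fix0 k : (phi ^+ k)%g 0 = 0.
Proof. by elim: k => [|k IH]; rewrite ?expg0 ?perm1 // expgSr permM IH skew.1. Qed.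

(* Commutativity makes phi^i agree with phi on the kernel for every power
   value i, and then moves across phi. *)
Lemma kernel_stable a : power_value 1 a 1 -> power_value 1 (phi a) 1.
Proof.
move=> Ha.
have E i y : power_value 1 y i -> (phi ^+ i)%g a = phi a.
  move=> Hy; have := Hy a; rewrite addrC Ha addrC !expg1.
  by move/addrI.
move=> c; rewrite !expg1 addrC.
have [i Hi] := skew.2 c.
have := Hi (phi a); rewrite expg1 => ->.
by rewrite -[(phi ^+ i)%g (phi a)]permM -expgS expgSr permM (E _ _ Hi) addrC.
Qed.

Hypothesis ord4 : #[phi]%g = 4%N.

Lemma expg_eq1 k : (phi ^+ k = 1)%g -> (4 %| k)%N.
Proof. by move=> H; rewrite -ord4 order_dvdn H. Qed.

Lemma perm_exp4 x : (phi ^+ 4)%g x = x.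
Proof. by rewrite -ord4 expg_order perm1. Qed.

(** If [phi ^+ i] were trivial, taking [b = - a] would show that [phi ^+ k] fixes [a], and
    translating by [a] that it fixes everything. *)
Lemma power_value_neq0 k a i : (0 < k < 4)%N -> power_value k a i -> ~~ (4 %| i)%N.
Proof.
move=> /andP[k0 k4] H; apply/negP => /dvdnP[j Ei].
have E1 b : (phi ^+ i)%g b = b.
  by rewrite Ei mulnC expgM -ord4 expg_order expg1n perm1.
have Ea : (phi ^+ k)%g a = a.
  have := H (- a); rewrite subrr iter_fix0 E1 => /esym/eqP.
  by rewrite subr_eq0 => /eqP.
have: (phi ^+ k = 1)%g.
  by apply/permP => x; rewrite perm1 -[in LHS](addNKr a x) addrA -addrA H E1 Ea addNKr.
by move/expg_eq1 => /(dvdn_leq k0); rewrite leqNgt k4.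
Qed.

Lemma power_value_mod k a i : power_value k a i -> power_value k a (i %% 4)%N.
Proof. by move=> H b; rewrite H -(expg_mod_order phi i) ord4. Qed.

Lemma power_value_123 a : exists2 i, (0 < i < 4)%N & power_value 1 a i.
Proof.
have [i /[dup] Hi /power_value_mod Hi'] := skew.2 a.
exists (i %% 4)%N => //; rewrite ltn_pmod // andbT lt0n.
exact: power_value_neq0 Hi.
Qed.

Lemma kernel_iter k a : power_value 1 a 1 -> power_value 1 ((phi ^+ k)%g a) 1.
Proof.
by elim: k => [|k IH] Ha; rewrite ?perm1 // expgSr permM; apply/kernel_stable/IH.
Qed.

(* The four power values along the orbit of a are the successive differences
   of a cyclic arrangement of Z_4, so a value 2 forces the arrangement
   1,2,3,2 up to rotation; this meets the kernel, which is phi-invariant. *)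
Lemma power_value_1or3 a : power_value 1 a 1 \/ power_value 1 a 3%N.
Proof.
have [p0 r0 H0] := power_value_123 a.
have [p1 r1 H1] := power_value_123 ((phi ^+ 1)%g a).
have [p2 r2 H2] := power_value_123 ((phi ^+ 2)%g a).
have [p3 r3 H3] := power_value_123 ((phi ^+ 3)%g a).
have H4 : power_value 1 ((phi ^+ 4)%g a) p0 by rewrite perm_exp4.
have C j k i i' : power_value 1 ((phi ^+ j)%g a) i -> k = j.+1 ->
  power_value 1 ((phi ^+ k)%g a) i' -> ~~ (4 %| i + i')%N.
  move=> Hi -> Hi'; apply: (@power_value_neq0 2 ((phi ^+ j)%g a)) => //.
  by apply: (power_value_comp (j := 1)) => //; rewrite expg1 -permM -expgSr.
have C0 : ~~ (4 %| p0 + p1)%N by apply: (C 0%N 1%N) => //; rewrite perm1.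
have C1 := C _ _ _ _ H1 erefl H2.
have C2 := C _ _ _ _ H2 erefl H3.
have C3 := C _ _ _ _ H3 erefl H4.
have S4 : (4 %| p0 + p1 + p2 + p3)%N.
  apply: expg_eq1; apply/permP => b; rewrite perm1.
  have := power_value_comp (power_value_comp (power_value_comp H0 H1) H2) H3.
  by move/(_ b); rewrite !perm_exp4 => /addrI.
have [K0 | K0] := eqVneq p0 1%N; first by left; rewrite K0 in H0.
have [K0' | K0'] := eqVneq p0 3%N; first by right; rewrite K0' in H0.
left.
(* Here [p0 = 2], so [p1] and [p3] cannot be 2; if both were 3, the total would force 4 to divide
   [p2]. *)
have: (p1 == 1)%N || (p3 == 1)%N.
  clear -r0 r1 r2 r3 C0 C1 C2 C3 S4 K0 K0'.
  have L p : (0 < p < 4)%N -> [\/ p = 1, p = 2 | p = 3]%N.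
    by case: p => [|[|[|[|p]]]] // _; [constructor 1 | constructor 2 | constructor 3].
  move: C0 C1 C2 C3 S4 K0 K0'.
  by case: (L _ r0) => ->; case: (L _ r1) => ->; case: (L _ r2) => ->;
     case: (L _ r3) => ->.
case/orP => /eqP E.
  rewrite E in H1; have := kernel_iter 3 H1.
  by rewrite -permM -expgD perm_exp4.
rewrite E in H3; have := kernel_iter 1 H3.
by rewrite -permM -expgD perm_exp4.
Qed.

(** The orbit of [a] avoids the kernel, so [phi] has value 3 all along it and [phi ^+ 3] has value 3
    + 3 + 3 = 1 modulo 4 at [a]. *)
Lemma power_value_double a : ~ power_value 1 a 1 ->
  power_value 1 a 3%N /\ power_value 1 (a + a) 1.
Proof.
move=> K0.
have K3 k : power_value 1 ((phi ^+ k)%g a) 3%N.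
  have [K|//] := power_value_1or3 ((phi ^+ k)%g a); case: K0.
  have := kernel_iter (k * 3)%N K.
  by rewrite -permM -expgD -mulnS mulnC expgM -ord4 expg_order expg1n perm1.
have Ha : power_value 1 a 3%N by have := K3 0%N; rewrite perm1.
split=> //; apply: (power_value_add Ha).
have := power_value_comp (power_value_comp Ha (K3 1%N)) (K3 2%N).
by move/power_value_mod.
Qed.
End PowerValues.

(** * Skew morphisms of order 4 as pairs modulo [m] *)

Section Coordinates.
Local Open Scope ring_scope.
Variables (n m : nat).
Hypotheses (m_gt1 : (1 < m)%N) (n_def : n = m.*2).

Let nS : n.-1.+1 = n.
Proof. by rewrite prednK // n_def double_gt0 ltnW. Qed.

(* [pt x e] is the class of 2x + e. *)
Definition pt (x : 'Z_m) (e : bool) : Zn n := inZp (x.*2 + e).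

Let natK (x : 'Z_m) : (x : nat)%:R = x. Proof. exact: natr_Zp. Qed.

Lemma pt_nat k e : pt k%:R e = inZp (k.*2 + e).
Proof.
apply/val_inj => /=; rewrite val_Zp_nat // nS n_def -!muln2 muln_modl.
by rewrite modnDml.
Qed.

Let inZpD a b : inZp a + inZp b = inZp (a + b) :> Zn n.
Proof. by apply/val_inj; rewrite /= modnDm. Qed.

Lemma ptD0 x y e : pt x false + pt y e = pt (x + y) e.
Proof.
rewrite -[x]natK -[y]natK -natrD !pt_nat inZpD; congr inZp.
by rewrite addn0 doubleD addnA.
Qed.

Lemma ptD1 x y : pt x true + pt y true = pt (x + y + 1) false.
Proof.
rewrite -[x]natK -[y]natK -natrD natr1 !pt_nat inZpD; congr inZp.
by rewrite addnACA -doubleD doubleS addn0 addn2.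
Qed.

Lemma pt_half (z : Zn n) : pt (z./2)%:R (odd z) = z.
Proof. by rewrite pt_nat addnC odd_double_half; apply: valZpK. Qed.

Lemma pt_inj x y e e' : pt x e = pt y e' -> x = y /\ e = e'.
Proof.
have lt_n (z : 'Z_m) (b : bool) : (z.*2 + b < n.-1.+1)%N.
  have: (z < m)%N by rewrite -{2}(Zp_cast m_gt1) ltn_ord.
  rewrite nS n_def -leq_double doubleS; apply: leq_trans.
  by case: b; rewrite ?addn1 ?addn0.
move/(congr1 (@nat_of_ord _)); rewrite /= !modn_small // => E.
have Ee : e = e'.
  by have := congr1 odd E; rewrite !oddD !odd_double !oddb.
split=> //; apply: val_inj => /=; move: E; rewrite Ee => /addIn.
exact: double_inj.
Qed.

Lemma pt00 : pt 0 false = 0.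
Proof. by apply/val_inj; rewrite /= mod0n. Qed.

Section Affine.
Variables r h : 'Z_m.

(* 2x goes to 2rx and 2x + 1 to 2(rx + h) + 1. *)
Definition affine (z : Zn n) : Zn n :=
  pt (r * (z./2)%:R + (if odd z then h else 0)) (odd z).

Lemma affineE x e : affine (pt x e) = pt (r * x + (if e then h else 0)) e.
Proof. by rewrite /affine; have [-> ->] := pt_inj (pt_half (pt x e)). Qed.
End Affine.

Lemma ptP (z : Zn n) : exists x e, z = pt x e.
Proof. by exists (z./2)%:R, (odd z); rewrite pt_half. Qed.

(** Given [r * r = 1], the square of [affine r h] fixes even residues and adds [h * (1 + r)] to the
    half of odd ones: the last two conditions say that the order is 4. The second one encodes the
    power value 3 at the residue 1. *)
Definition sol (u : 'Z_m * 'Z_m) : bool :=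
  let: (r, h) := u in
  [&& r * r == 1, r * (1 + h) == 1 + h, 2 * (h * (1 + r)) == 0 & h * (1 + r) != 0].

Lemma skew_sol (phi : {perm Zn n}) : proper_skew_of_order 4 phi ->
  exists2 u, sol u & phi =1 affine u.1 u.2.
Proof.
move=> [sk [nauto ord4]].
have skew : skew_perm phi.
  by split=> [|a]; [exact: sk.1 | have [i Hi] := sk.2 a; exists i => b; rewrite expg1].
set one := pt 0 true.
have D2 : one + one = pt 1 false by rewrite ptD1 !add0r.
have ker_double k : power_value phi 1 (pt 1 false) 1 -> power_value phi 1 (pt k%:R false) 1.
  move=> H; elim: k => [|k IH].
    by rewrite pt00 => b; rewrite !expg1 skew.1 !add0r.
  by rewrite -natr1 -ptD0; apply: (power_value_add IH H).
(* The residue 1 generates the group, so its presence in the kernel would make [phi] an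
   automorphism. *)
have not1 : ~ power_value phi 1 one 1.
  move=> H; case: nauto => a b; suff: power_value phi 1 a 1 by move/(_ b); rewrite !expg1.
  have [x [e ->]] := ptP a.
  have Hx : power_value phi 1 (pt x false) 1.
    rewrite -[x]natK; apply: ker_double; rewrite -D2; exact: (power_value_add H H).
  case: e => //; rewrite -[x]addr0 -ptD0; exact: (power_value_add Hx H).
have [one3 two1] := power_value_double skew ord4 not1.
rewrite D2 in two1.
have even1 x : power_value phi 1 (pt x false) 1 by rewrite -[x]natK; exact: ker_double.
have odd_n1 x : ~ power_value phi 1 (pt x true) 1.
  move=> H; apply: not1; rewrite /one -(addNr x) -ptD0.
  exact: (power_value_add (even1 _) H).
have [r Er] : exists r, phi (pt 1 false) = pt r false.
  have [r [[] E]] := ptP (phi (pt 1 false)); last by exists r.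
  by case: (odd_n1 r); rewrite -E; apply: kernel_stable.
(* An even image would lie in the kernel, and three more applications of [phi] would carry it back
   to 1 inside the kernel. *)
have [h Eh] : exists h, phi one = pt h true.
  have [h [[] E]] := ptP (phi one); first by exists h.
  case: not1; rewrite -(perm_exp4 ord4 one).
  rewrite (expgS _ 3) permM E; apply: kernel_iter => //; exact: even1.
have phi0 x : phi (pt x false) = pt (r * x) false.
  rewrite -[x]natK; elim: (x : nat) => [|k IH]; first by rewrite mulr0 pt00 skew.1.
  rewrite -natr1 -ptD0; have := even1 k%:R (pt 1 false); rewrite !expg1 => ->.
  by rewrite IH Er ptD0 mulrDr mulr1.
have phi1 x : phi (pt x true) = pt (r * x + h) true.
  have := even1 x one; rewrite !expg1 /one ptD0 addr0 => ->.
  by rewrite phi0 Eh ptD0.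
have I3 x : (phi ^+ 3)%g x = phi (phi (phi x)) by rewrite !expgS expg0 !permM perm1.
have I4 x : phi (phi (phi (phi x))) = x by rewrite -[RHS](perm_exp4 ord4) !expgS expg0 !permM perm1.
(* The value 3 at 1, tested on the residue 2, gives [r = r ^ 3]; with [r ^ 4 = 1] this yields
   [r * r = 1]. *)
have := one3 (pt 1 false); rewrite expg1 I3 [one + _]addrC (ptD0 1 0) !phi0 phi1 Eh
  [pt h _ + _]addrC ptD0.
move=> /pt_inj[/addIr Q1 _]; rewrite addr0 !mulr1 in Q1.
have := I4 (pt 1 false); rewrite !phi0 => /pt_inj[Q2 _]; rewrite mulr1 in Q2.
have r2 : r * r = 1.
  by rewrite -[RHS]Q2 -Q1.
have := one3 one; rewrite expg1 I3 D2 Er Eh !phi1 ptD1 => /pt_inj[Q3 _].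
have := I4 one; rewrite !phi1 => /pt_inj[Q4 _].
have hr : h * (1 + r) != 0.
  apply/eqP => Q5.
  have: (phi ^+ 2 = 1)%g.
    apply/permP => z; rewrite !expgS expg0 !permM !perm1.
    have [x [[] ->]] := ptP z; rewrite ?phi0 ?phi1; congr pt.
      have -> : r * (r * x + h) + h = r * r * x + h * (1 + r) by ring.
      by rewrite r2 Q5 mul1r addr0.
    by rewrite mulrA r2 mul1r.
  by move/(expg_eq1 ord4).
have Q6 : 2 * (h * (1 + r)) = 0.
  rewrite -[RHS]Q4 [RHS](_ : _ = r * (r * r) * h + r * r * h + r * h + h); last by ring.
  by rewrite r2; ring.
exists (r, h) => [|z /=].
  apply/and4P; split; rewrite ?r2 ?Q6 //; apply/eqP.
  have := congr1 (+%R^~ (r * h - h)) Q3.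
  rewrite (_ : r + (r * h - h) = r * (1 + h) - h); last by ring.
  rewrite (_ : h + (r * (r * h + h) + h) + 1 + (r * h - h) =
               r * r * h - h + 2 * (h * (1 + r)) + 1); last by ring.
  by rewrite r2 Q6 mul1r subrr !add0r => /(canRL (subrK _)).
by have [x [[] ->]] := ptP z; rewrite affineE ?phi0 ?phi1 ?addr0.
Qed.

Lemma sol_skew (r h : 'Z_m) : sol (r, h) ->
  exists2 phi : {perm Zn n}, proper_skew_of_order 4 phi & phi =1 affine r h.
Proof.
case/and4P => /eqP r2 /eqP S2 /eqP S3 S4.
pose f := affine r h.
have f0 x : f (pt x false) = pt (r * x) false by rewrite /f affineE addr0.
have f1 x : f (pt x true) = pt (r * x + h) true by rewrite /f affineE.
have fE : f =1 affine r h by [].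
clearbody f.
have ff0 x : f (f (pt x false)) = pt x false by rewrite !f0 mulrA r2 mul1r.
have ff1 x : f (f (pt x true)) = pt (x + h * (1 + r)) true.
  rewrite !f1; congr pt; rewrite mulrDr mulrA r2; ring.
have f4 x : f (f (f (f x))) = x.
  have [y [[] ->]] := ptP x; rewrite ?ff0 ?ff1 //; congr pt.
  by rewrite -[RHS]addr0 -S3; ring.
have f_inj : injective f by apply: (can_inj (g := f \o f \o f)) => x /=.
pose phi := perm f_inj.
have phiE : phi =1 f by move=> z; rewrite permE.
have E2 z : (phi ^+ 2)%g z = f (f z) by rewrite !expgS expg0 !permM perm1 !phiE.
have E3 z : (phi ^+ 3)%g z = f (f (f z)).
  by rewrite !expgS expg0 !permM perm1 !phiE.
have D0 x b : f (pt x false + b) = f (pt x false) + f b.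
  by have [y [[] ->]] := ptP b; rewrite ptD0 ?f1 !f0 ptD0 mulrDr ?addrA.
(* The value 3 is checked at 1 only; [D0] transports it to the other odd residues. *)
have D1 b : f (pt 0 true + b) = f (pt 0 true) + f (f (f b)).
  have [y [[] ->]] := ptP b; last first.
    by rewrite ff0 [pt 0 true + _]addrC ptD0 addr0 f0 !f1
      [pt _ true + _]addrC ptD0 mulr0 add0r.
  rewrite ptD1 ff1 f0 !f1 ptD1; congr pt.
  rewrite add0r mulr0 add0r.
  have -> : r * (y + 1) = r * (1 + h) + r * y - r * h by ring.
  have -> : h + (r * (y + h * (1 + r)) + h) + 1 =
    1 + h + r * y - r * h + (r * r - 1) * h + 2 * (h * (1 + r)) by ring.
  by rewrite S2 r2 S3; ring.
exists phi; last by move=> z; rewrite phiE fE.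
have phi4 : (phi ^+ 4 = 1)%g.
  by apply/permP => z; rewrite !expgS expg0 !permM !perm1 !phiE.
have phi2 : (phi ^+ 2 != 1)%g.
  apply: contra S4 => /eqP/permP/(_ (pt 0 true)).
  by rewrite E2 perm1 ff1 => /pt_inj[/eqP]; rewrite add0r.
have ord4 : #[phi]%g = 4%N.
  have d4 : (#[phi]%g %| 4)%N by rewrite order_dvdn phi4.
  have d2 : ~~ (#[phi]%g %| 2)%N by rewrite order_dvdn.
  by case: #[phi]%g d4 d2 (dvdn_leq (isT : (0 < 4)%N) d4) => [|[|[|[|[|]]]]].
have one3 b : phi (pt 0 true + b) = phi (pt 0 true) + (phi ^+ 3)%g b.
  by rewrite E3 !phiE D1.
split; first split.
- by rewrite phiE -pt00 f0 mulr0.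
- move=> a; have [x [[] ->]] := ptP a; last first.
    by exists 1%N => b; rewrite expg1 !phiE D0.
  by exists 3%N => b; rewrite E3 !phiE -[x]addr0 -ptD0 -addrA !D0 D1 addrA.
split=> // hom.
(* An automorphism would have both values 1 and 3 at the residue 1, making [phi ^+ 2] trivial. *)
case/negP: phi2; apply/eqP/permP => b; rewrite perm1.
have := hom (pt 0 true) b; rewrite one3 => /addrI.
by rewrite expgSr permM => /perm_inj.
Qed.

Lemma affine_inj r h r' h' : affine r h =1 affine r' h' -> (r, h) = (r', h').
Proof.
move=> E; have /pt_inj[] : pt r false = pt r' false.
  by have := E (pt 1 false); rewrite !affineE !addr0 !mulr1.
have /pt_inj[] : pt h true = pt h' true.
  by have := E (pt 0 true); rewrite !affineE !mulr0 !add0r.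
by move=> -> _ -> _.
Qed.

Lemma has_card_sol : has_card (@proper_skew_of_order n 4) #|[pred u | sol u]|.
Proof.
pose F (u : 'Z_m * 'Z_m) : {perm Zn n} :=
  (* The default arises only when the affine map is not a permutation, hence never on a solution. *)
  odflt 1%g [pick phi : {perm Zn n} | [forall z, phi z == affine u.1 u.2 z]].
have FE u : sol u -> proper_skew_of_order 4 (F u) /\ F u =1 affine u.1 u.2.
  case: u => r h /sol_skew[phi Hphi E].
  suff -> : F (r, h) = phi by [].
  rewrite /F; case: pickP => [psi /forallP Epsi | /(_ phi)/forallP[] z] /=.
    by apply/permP => z; rewrite (eqP (Epsi z)) E.
  by rewrite E.
exists [seq F u | u <- enum [pred u | sol u]]; split; last split.
- rewrite map_inj_in_uniq ?enum_uniq // => [[r h] [r' h']].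
  rewrite !mem_enum => /FE[_ E] /FE[_ E'] eqF.
  by apply: affine_inj => z; rewrite -E -E' eqF.
- move=> phi; split=> [/mapP[u] | Hphi].
    by rewrite mem_enum => /FE[? _] ->.
  have [u Su E] := skew_sol Hphi; apply/mapP; exists u; first by rewrite mem_enum.
  by apply/permP => z; rewrite E (FE u Su).2.
- by rewrite size_map -cardE.
Qed.
End Coordinates.

(** * Counting pairs by the Chinese remainder theorem *)

Lemma sum_crt a b (F : nat -> nat -> nat) : 0 < a -> 0 < b -> coprime a b ->
  \sum_(0 <= x < a * b) F (x %% a) (x %% b) =
  \sum_(0 <= i < a) \sum_(0 <= j < b) F i j.
Proof.
move=> a0 b0 co; rewrite !big_mkord.
under [RHS]eq_bigr do rewrite big_mkord.
rewrite pair_bigA /=.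
pose g (x : 'I_(a * b)) := (Ordinal (ltn_pmod x a0), Ordinal (ltn_pmod x b0)).
rewrite (reindex g) //=; apply: onW_bij; apply: inj_card_bij; last first.
  by rewrite card_prod !card_ord.
move=> x y [Ea Eb]; apply/val_inj => /=.
rewrite -[LHS](modn_small (ltn_ord x)) -[RHS](modn_small (ltn_ord y)).
by apply/eqP; rewrite chinese_remainder // Ea Eb !eqxx.
Qed.

Definition count2 (P : nat -> nat -> bool) (m : nat) : nat :=
  \sum_(0 <= r < m) \sum_(0 <= h < m) P r h.

(** Periodicity lets [P] and [Q] be read on residues; the sum over [h] then factors for each fixed
    [r], and afterwards the sum over [r]. *)
Lemma count2_crt a b (P Q : nat -> nat -> bool) :
  0 < a -> 0 < b -> coprime a b ->
  (forall r h, P (r %% a) (h %% a) = P r h) ->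
  (forall r h, Q (r %% b) (h %% b) = Q r h) ->
  count2 (fun r h => P r h && Q r h) (a * b) = count2 P a * count2 Q b.
Proof.
move=> a0 b0 co Pa Qb.
have inner r : \sum_(0 <= h < a * b) (P r h && Q r h) =
    (\sum_(0 <= h < a) P (r %% a) h) * (\sum_(0 <= h < b) Q (r %% b) h).
  under eq_bigr => h _ do rewrite -Pa -Qb -mulnb.
  by rewrite (sum_crt (fun i j => P (r %% a) i * Q (r %% b) j)) // big_distrlr.
rewrite /count2; under eq_bigr => r _ do rewrite inner.
rewrite (sum_crt (fun i j => (\sum_(0 <= h < a) P i h) * (\sum_(0 <= h < b) Q j h))) //.
by rewrite big_distrlr.
Qed.

(** The system [sol] on natural numbers, where the modulus can be factored freely and may be 1,
    whereas ['Z_1] has two elements. *)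
Definition nat_sol m r h : bool :=
  [&& r * r == 1 %[mod m], r * (1 + h) == 1 + h %[mod m],
      2 * (h * (1 + r)) == 0 %[mod m] & h * (1 + r) != 0 %[mod m]].

Definition nat_sol_odd m r h : bool :=
  [&& r * r == 1 %[mod m], r * (1 + h) == 1 + h %[mod m] &
      h * (1 + r) == 0 %[mod m]].

Section Periodicity.
Variables m r h : nat.

Let rr_mod : r %% m * (r %% m) = r * r %[mod m].
Proof. by rewrite modnMm. Qed.

Let rh_mod : r %% m * (1 + h %% m) = r * (1 + h) %[mod m].
Proof. by rewrite -[LHS]modnMm modn_mod modnDmr modnMm. Qed.

Let hr_mod : h %% m * (1 + r %% m) = h * (1 + r) %[mod m].
Proof. by rewrite -[LHS]modnMm modn_mod modnDmr modnMm. Qed.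

Lemma nat_sol_mod : nat_sol m (r %% m) (h %% m) = nat_sol m r h.
Proof.
have hr2_mod : 2 * (h %% m * (1 + r %% m)) = 2 * (h * (1 + r)) %[mod m].
  by rewrite -modnMmr hr_mod modnMmr.
by rewrite /nat_sol rr_mod rh_mod modnDmr hr_mod hr2_mod.
Qed.

Lemma nat_sol_odd_mod : nat_sol_odd m (r %% m) (h %% m) = nat_sol_odd m r h.
Proof. by rewrite /nat_sol_odd rr_mod rh_mod modnDmr hr_mod. Qed.
End Periodicity.

(* Modulo the odd q the factor 2 cancels, so the third condition already forces
   the negation of the last one: non-triviality is decided modulo 8. *)
Lemma nat_sol_split q r h : odd q ->
  nat_sol (8 * q) r h = nat_sol 8 r h && nat_sol_odd q r h.
Proof.
move=> q_odd; have co : coprime 8 q by rewrite (@coprime_pexpl 3 2) // coprime2n.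
rewrite /nat_sol /nat_sol_odd !chinese_remainder //.
have -> : (2 * (h * (1 + r)) == 0 %[mod q]) = (h * (1 + r) == 0 %[mod q]).
  by rewrite !mod0n; apply: Gauss_dvdr; rewrite coprimen2.
by do 7!case: (_ == _ %[mod _]).
Qed.

Lemma nat_sol_odd_mul a b r h : coprime a b ->
  nat_sol_odd (a * b) r h = nat_sol_odd a r h && nat_sol_odd b r h.
Proof.
move=> co; rewrite /nat_sol_odd !chinese_remainder //.
by do 6!case: (_ == _ %[mod _]).
Qed.

(** * Local counts and their product *)

(** Exhaustive computation; the pairs are (1, 2), (1, 6), (3, 3) and (3, 7). *)
Lemma count2_8 : count2 (nat_sol 8) 8 = 4.
Proof. by rewrite /count2 unlock; vm_compute. Qed.

Lemma eq_natr_Zp m a b : 1 < m -> (a%:R == b%:R :> 'Z_m)%R = (a == b %[mod m]).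
Proof. by move=> m1; rewrite -val_eqE /= !val_Zp_nat. Qed.

Lemma count2_Zp m (P : nat -> nat -> bool) : 1 < m ->
  count2 P m = #|[pred u : 'Z_m * 'Z_m | P u.1 u.2]|.
Proof.
move=> m1; rewrite /count2 -{1 2}(Zp_cast m1) big_mkord.
under eq_bigr do rewrite big_mkord.
by rewrite pair_bigA /= -sum1_card [RHS]big_mkcond; apply: eq_bigr => u _;
  rewrite inE; case: (P _ _).
Qed.

Lemma nat_sol_oddE m (r h : 'Z_m) : 1 < m ->
  nat_sol_odd m r h = [&& r * r == 1, r * (1 + h) == 1 + h & h * (1 + r) == 0]%R.
Proof.
move=> m1; rewrite /nat_sol_odd -!eq_natr_Zp //.
by rewrite !(natrM, natrD) !natr_Zp.
Qed.

(** In a field [r] is 1 or -1. The third condition then reads [2 * h = 0] in the first case, the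
    second reads [2 * (1 + h) = 0] in the other, and 2 is invertible. *)
Lemma count2_prime p : prime p -> odd p -> count2 (nat_sol_odd p) p = 2.
Proof.
move=> p_pr p_odd; have p1 := prime_gt1 p_pr.
have two : (2 : 'F_p)%R != 0%R.
  rewrite -[2%R]/(2%:R)%R -[0%R]/(0%:R)%R eq_natr_Zp pdiv_id // mod0n modn_small //.
  by rewrite ltn_neqAle p1 andbT; apply: contraTneq p_odd => <-.
have neq : (1, 0)%R != (-1, -1)%R :> 'F_p * 'F_p.
  by apply: contraNneq two => /(congr1 fst)/= E; rewrite mulr2n {2}E subrr.
have pdiv_gt1 : 1 < pdiv p by rewrite pdiv_id.
(* ['F_p] is ['Z_(pdiv p)], so this form of the modulus gives access to the field structure. *)
rewrite -(pdiv_id p_pr) (count2_Zp _ pdiv_gt1).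
transitivity #|[set (1, 0)%R; (-1, -1)%R : 'F_p * 'F_p]|; last by rewrite cards2 neq.
apply: eq_card => [[r h]]; rewrite !inE /= (nat_sol_oddE _ _ pdiv_gt1).
apply/idP/idP; last first.
  by case/orP => /eqP[-> ->]; apply/and3P; split; apply/eqP; ring.
case/and3P; rewrite -expr2 sqrf_eq1 => /orP[] /eqP -> /eqP H1 /eqP H2; rewrite !xpair_eqE eqxx /=.
  by move/eqP: H2; rewrite mulf_eq0 (negPf two) orbF => ->.
apply/orP; right; rewrite -subr_eq0 opprK addrC.
have /eqP : (2 * (1 + h) = 0)%R by rewrite -[RHS](subrr (1 + h)%R) -{3}H1; ring.
by rewrite mulf_eq0 (negPf two).
Qed.

Lemma count2_prod ps : uniq ps -> all (fun p => prime p && odd p) ps ->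
  count2 (nat_sol_odd (\prod_(p <- ps) p)) (\prod_(p <- ps) p) = 2 ^ size ps.
Proof.
elim: ps => [|p ps IH] /=; first by rewrite big_nil /count2 !big_nat1.
move=> /andP[p_notin u] /andP[/andP[p_pr p_odd] Hps].
rewrite big_cons; set q := \prod_(_ <- _) _ in IH *.
have co : coprime p q.
  rewrite prime_coprime // /q Euclid_dvd_prod // big_has; apply/hasPn => p' p'_in /=.
  have /andP[p'_pr _] := allP Hps _ p'_in.
  by rewrite dvdn_prime2 //; apply: contraNneq p_notin => ->.
rewrite expnS -IH // -(count2_prime p_pr p_odd) -count2_crt //.
- by apply: eq_bigr => r _; apply: eq_bigr => h _; rewrite nat_sol_odd_mul.
- exact: prime_gt0.
- rewrite /q big_seq prodn_cond_gt0 // => p' p'_in.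
  by have /andP[/prime_gt0] := allP Hps _ p'_in.
- exact: nat_sol_odd_mod.
- exact: nat_sol_odd_mod.
Qed.

Lemma prod_primes_odd ps : all (fun p => prime p && odd p) ps ->
  odd (\prod_(p <- ps) p).
Proof.
elim: ps => [|p ps IH]; rewrite ?big_nil ?big_cons //= => /andP[/andP[_ p_odd] /IH].
by rewrite oddM p_odd.
Qed.

Lemma count2_nat_sol ps : uniq ps -> all (fun p => prime p && odd p) ps ->
  let q := \prod_(p <- ps) p in
  count2 (nat_sol (8 * q)) (8 * q) = 2 ^ (size ps + 2).
Proof.
move=> u Hps q; have q_odd : odd q := prod_primes_odd Hps.
rewrite expnD [RHS]mulnC -[2 ^ 2]count2_8 -count2_prod // -count2_crt //.
- by apply: eq_bigr => r _; apply: eq_bigr => h _; rewrite nat_sol_split.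
- exact: odd_gt0.
- by rewrite (@coprime_pexpl 3 2) // coprime2n.
- exact: nat_sol_mod.
- exact: nat_sol_odd_mod.
Qed.

Lemma odd_primes_exist k : exists ps : seq nat,
  [/\ uniq ps, all (fun p => prime p && odd p) ps & size ps = k].
Proof.
elim: k => [|k [ps [u Hps sz]]]; first by exists [::].
(* Exceeding the sum makes the prime new, and exceeding 2 makes it odd. *)
have [p p_gt p_pr] := prime_above (2 + \sum_(p <- ps) p).
exists (p :: ps); split=> /=; rewrite ?sz ?Hps ?u ?andbT ?p_pr //.
  apply: contraTN p_gt => p_in; rewrite (big_rem p) //= -leqNgt.
  by rewrite addnCA leq_addr.
have p_gt2 : 2 < p by apply: leq_ltn_trans p_gt; rewrite leq_addr.
by case/even_prime: (p_pr) p_gt2 => [->|].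
Qed.

Lemma card_sol m : 1 < m -> #|[pred u : 'Z_m * 'Z_m | sol u]| = count2 (nat_sol m) m.
Proof.
move=> m1; rewrite count2_Zp //; apply: eq_card => -[r h].
rewrite !inE /nat_sol /= -!eq_natr_Zp //.
by rewrite !(natrM, natrD) !natr_Zp.
Qed.

Theorem theorem6p7 :
  (forall ps : seq nat, uniq ps -> all (fun p => prime p && odd p) ps ->
     has_card (@proper_skew_of_order (16 * \prod_(p <- ps) p) 4)
              (2 ^ (size ps + 2)))
  /\ ~ skew_bounded 4.
Proof.
have main (ps : seq nat) : uniq ps -> all (fun p => prime p && odd p) ps ->
    has_card (@proper_skew_of_order (16 * \prod_(p <- ps) p) 4) (2 ^ (size ps + 2)).
  move=> u Hps; rewrite -count2_nat_sol //.
  have m1 : 1 < 8 * \prod_(p <- ps) p.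
    by rewrite (@leq_trans 8) // leq_pmulr // odd_gt0 // prod_primes_odd.
  rewrite -card_sol //; apply: has_card_sol => //.
  by rewrite -mul2n mulnA.
split=> // -[C bounded].
(* With [C] primes the count is [2 ^ (C + 2)], which exceeds [C]. *)
have [ps [u Hps sz]] := odd_primes_exist C.
have n_gt0 : 0 < 16 * \prod_(p <- ps) p by rewrite muln_gt0 /= odd_gt0 // prod_primes_odd.
have := bounded _ n_gt0 _ (main ps u Hps).
by rewrite sz leqNgt (leq_trans (ltn_expl C (isT : 1 < 2))) // leq_exp2l // leq_addr.
Qed.
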